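(* Let $(\mathcal{C},\mathbb{E},\mathfrak{s})$ be an extriangulated category and let $\mathcal{X}$ be a pseudo cluster tilting subcategory of $\mathcal{C}$. Let $\mathscr{S}$ and $\mathscr{T}$ be the two classes of $\mathbb{E}$-triangles in $\mathcal{C}$ (depending on $\mathcal{X}$) defined in the context. Then the following statements are equivalent. (1) The quotient category $\mathcal{C}/\mathcal{X}$ is an abelian category. (2) $\mathcal{X}$ is self-orthogonal with respect to $\mathscr{S}$. (3) $\mathcal{X}$ is self-orthogonal with respect to $\mathscr{T}$.
   Context: **Extriangulated categories (Nakaoka–Palu).** Let $\mathcal{C}$ be an additive category and $\mathbb{E}:\mathcal{C}^{\mathrm{op}}\times\mathcal{C}\to\mathrm{Ab}$ an additive bifunctor. An element $\delta\in\mathbb{E}(C,A)$ is called an $\mathbb{E}$-extension. For $a:A\to A'$ and $c:C'\to C$ put $a_*\delta=\mathbb{E}(C,a)(\delta)\in\mathbb{E}(C,A')$ and $c^*\delta=\mathbb{E}(c,A)(\delta)\in\mathbb{E}(C',A)$. A morphism of extensions from $\delta\in\mathbb{E}(C,A)$ to $\delta'\in\mathbb{E}(C',A')$ is a pair $(a:A\to A',\,c:C\to C')$ with $a_*\delta=c^*\delta'$. Two sequences $A\xrightarrow{x}B\xrightarrow{y}C$ and $A\xrightarrow{x'}B'\xrightarrow{y'}C$ are equivalent if there is an isomorphism $b:B\to B'$ with $bx=x'$ and $y'b=y$. A realization $\mathfrak{s}$ assigns to each $\delta\in\mathbb{E}(C,A)$ an equivalence class $\mathfrak{s}(\delta)=[A\xrightarrow{x}B\xrightarrow{y}C]$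 such that for every morphism $(a,c):\delta\to\delta'$, with $\mathfrak{s}(\delta)=[A\xrightarrow{x}B\xrightarrow{y}C]$ and $\mathfrak{s}(\delta')=[A'\xrightarrow{x'}B'\xrightarrow{y'}C']$, there is $b:B\to B'$ with $bx=x'a$ and $y'b=cy$. It is additive if $\mathfrak{s}(0)=[A\to A\oplus C\to C]$ (canonical injection and projection) and $\mathfrak{s}(\delta\oplus\delta')=\mathfrak{s}(\delta)\oplus\mathfrak{s}(\delta')$. The triple $(\mathcal{C},\mathbb{E},\mathfrak{s})$ is an extriangulated category if $\mathbb{E}$ is an additive bifunctor, $\mathfrak{s}$ is an additive realization of $\mathbb{E}$, and the following hold. (ET3) If $\mathfrak{s}(\delta)=[A\xrightarrow{x}B\xrightarrow{y}C]$, $\mathfrak{s}(\delta')=[A'\xrightarrow{x'}B'\xrightarrow{y'}C']$ and $a:A\to A'$, $b:B\to B'$ satisfy $bx=x'a$, then there is $c:C\to C'$ with $cy=y'b$ and $a_*\delta=c^*\delta'$. (ET3)$^{\mathrm{op}}$ Dually, given $b,c$ with $y'b=cy$ there is $a$ with $bx=x'a$ and $a_*\delta=c^*\delta'$. (ET4) If $\delta\in\mathbb{E}(D,A)$ and $\delta'\in\mathbb{E}(F,B)$ are realized by $A\xrightarrow{f}B\xrightarrow{f'}D$ and $B\xrightarrow{g}C\xrightarrow{g'}F$, then there are an object $W$, morphisms $h':C\to W$, $d:D\to W$, $e:W\to F$ and $\delta''\in\mathbb{E}(W,A)$ realized by $A\xrightarrow{gf}C\xrightarrow{h'}W$ such that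 $h'g=df'$, $eh'=g'$, $D\xrightarrow{d}W\xrightarrow{e}F$ realizes $f'_*\delta'$, $d^*\delta''=\delta$ and $f_*\delta''=e^*\delta'$. (ET4)$^{\mathrm{op}}$ The dual of (ET4). An $\mathbb{E}$-triangle $A\xrightarrow{x}B\xrightarrow{y}C\overset{\delta}{\dashrightarrow}$ is a sequence $A\xrightarrow{x}B\xrightarrow{y}C$ together with $\delta\in\mathbb{E}(C,A)$ such that $\mathfrak{s}(\delta)=[A\xrightarrow{x}B\xrightarrow{y}C]$ (the symbol $\delta$ may be omitted). A morphism of $\mathbb{E}$-triangles from $A\xrightarrow{x}B\xrightarrow{y}C\overset{\delta}{\dashrightarrow}$ to $A'\xrightarrow{x'}B'\xrightarrow{y'}C'\overset{\delta'}{\dashrightarrow}$ is a triple $(a,b,c)$ with $bx=x'a$, $y'b=cy$ and $a_*\delta=c^*\delta'$. An $\mathbb{E}$-triangle splits if $\delta=0$ (equivalently, $x$ is a section, equivalently $y$ is a retraction). **Approximations.** All subcategories are full. For a subcategory $\mathcal{X}$ of $\mathcal{C}$, a morphism $f:A\to B$ is a left $\mathcal{X}$-approximation of $A$ if $B\in\mathcal{X}$ and $\mathcal{C}(f,X):\mathcal{C}(B,X)\to\mathcal{C}(A,X)$ is surjective for all $X\in\mathcal{X}$; it is a right $\mathcal{X}$-approximation of $B$ if $A\in\mathcal{X}$ and $\mathcal{C}(X,f):\mathcal{C}(X,A)\to\mathcal{C}(X,B)$ is surjective for all $X\in\mathcal{X}$. **Pseudo cluster tilting.** $\mathcal{X}$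 is a pseudo cluster tilting subcategory of $\mathcal{C}$ if: $(2')$ for any $C\in\mathcal{C}$ there is an $\mathbb{E}$-triangle $C\xrightarrow{a}X_1\xrightarrow{b}X_2\dashrightarrow$ with $X_1,X_2\in\mathcal{X}$ and $a$ a left $\mathcal{X}$-approximation of $C$; $(3')$ for any $C\in\mathcal{C}$ there is an $\mathbb{E}$-triangle $X_3\xrightarrow{c}X_4\xrightarrow{d}C\dashrightarrow$ with $X_3,X_4\in\mathcal{X}$ and $d$ a right $\mathcal{X}$-approximation of $C$. **Quotient category.** $\mathcal{X}$ is assumed closed under finite direct sums. $\mathcal{C}/\mathcal{X}$ has the same objects as $\mathcal{C}$ and morphism groups $\mathrm{Hom}_{\mathcal{C}}(A,B)/\mathcal{X}(A,B)$, where $\mathcal{X}(A,B)$ is the subgroup of morphisms $A\to B$ factoring through an object of $\mathcal{X}$. **Relative exactness.** An $\mathbb{E}$-triangle $A\to B\to C\dashrightarrow$ is $\mathcal{C}(\mathcal{X},-)$-exact if for every $X\in\mathcal{X}$ the sequence $\mathcal{C}(X,A)\to\mathcal{C}(X,B)\to\mathcal{C}(X,C)\to0$ is exact in $\mathrm{Ab}$; it is $\mathcal{C}(-,\mathcal{X})$-exact if for every $X\in\mathcal{X}$ the sequence $\mathcal{C}(C,X)\to\mathcal{C}(B,X)\to\mathcal{C}(A,X)\to0$ is exact in $\mathrm{Ab}$. **The class $\mathscr{S}$.** An $\mathbb{E}$-triangle $S_1\to S_2\to S_3\dashrightarrow$ belongs to $\mathscr{S}$ if there is a commutative diagram of $\mathbb{E}$-triangles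 with rows $U\to S_1\to M_1\dashrightarrow$ and $U\to S_2\to M_2\dashrightarrow$ and columns $S_1\to S_2\to S_3\dashrightarrow$ (the given one) and $M_1\to M_2\to S_3\dashrightarrow$; that is, $(\mathrm{id}_U,\,S_1\to S_2,\,M_1\to M_2)$ is a morphism from the first row to the second row and $(S_1\to M_1,\,S_2\to M_2,\,\mathrm{id}_{S_3})$ is a morphism from the first column to the second column; and moreover $U\to S_2\to M_2\dashrightarrow$ is $\mathcal{C}(\mathcal{X},-)$-exact and $M_1\to M_2\to S_3\dashrightarrow$ is $\mathcal{C}(-,\mathcal{X})$-exact. **The class $\mathscr{T}$.** Dually, an $\mathbb{E}$-triangle $T_1\to T_2\to T_3\dashrightarrow$ belongs to $\mathscr{T}$ if there is a commutative diagram of $\mathbb{E}$-triangles with rows $T_1\to N_2\to N_3\dashrightarrow$ and $T_1\to T_2\to T_3\dashrightarrow$ (the given one) and columns $N_2\to T_2\to V\dashrightarrow$ and $N_3\to T_3\to V\dashrightarrow$; that is, $(\mathrm{id}_{T_1},\,N_2\to T_2,\,N_3\to T_3)$ is a morphism from the first row to the second row and $(N_2\to N_3,\,T_2\to T_3,\,\mathrm{id}_V)$ is a morphism from the first column to the second column; and moreover $N_2\to T_2\to V\dashrightarrow$ is $\mathcal{C}(-,\mathcal{X})$-exact and $T_1\to N_2\to N_3\dashrightarrow$ is $\mathcal{C}(\mathcal{X},-)$-exact. **Self-orthogonality.** For a class $\mathscr{Y}$ of $\mathbb{E}$-triangles in $\mathcal{C}$, $\mathcal{X}$ is self-orthogonal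 with respect to $\mathscr{Y}$ if every $\mathbb{E}$-triangle $D\to E\to F\dashrightarrow$ belonging to $\mathscr{Y}$ with $D,F\in\mathcal{X}$ splits. *)

(* Defs.v *)
From HB Require Import structures.
From mathcomp Require Import all_boot all_algebra.
From mathcomp Require Import boolp.

Set Implicit Arguments.
Unset Strict Implicit.
Unset Printing Implicit Defensive.

Import GRing.Theory.
Local Open Scope ring_scope.
Local Open Scope quotient_scope.

(** * Additive categories *)

Reserved Notation "g \c f" (at level 40, left associativity).

Record preadditive_category := PreadditiveCategory {
  obj :> Type;
  hom : obj -> obj -> zmodType;
  idm : forall A, hom A A;
  comp : forall A B D, hom B D -> hom A B -> hom A D
    where "g \c f" := (comp g f);
  compA : forall A B D F (h : hom D F) (g : hom B D) (f : hom A B),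
    h \c (g \c f) = (h \c g) \c f;
  comp1m : forall A B (f : hom A B), idm B \c f = f;
  compm1 : forall A B (f : hom A B), f \c idm A = f;
  compDl : forall A B D (g g' : hom B D) (f : hom A B),
    (g + g') \c f = g \c f + g' \c f;
  compDr : forall A B D (g : hom B D) (f f' : hom A B),
    g \c (f + f') = g \c f + g \c f'
}.

Arguments hom {p} A B : rename.
Arguments idm {p} A : rename.

Notation "g \c f" := (comp g f).

Definition is_zero_object (C : preadditive_category) (Z : C) : Prop :=
  (forall A (f : hom A Z), f = 0) /\ (forall A (f : hom Z A), f = 0).

Record biproduct (C : preadditive_category) (A B : C) := Biproduct {
  bip_obj :> C;
  bip_i1 : hom A bip_obj;
  bip_i2 : hom B bip_obj;
  bip_p1 : hom bip_obj A;
  bip_p2 : hom bip_obj B;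
  bip_p1i1 : bip_p1 \c bip_i1 = idm A;
  bip_p2i2 : bip_p2 \c bip_i2 = idm B;
  bip_p1i2 : bip_p1 \c bip_i2 = 0;
  bip_p2i1 : bip_p2 \c bip_i1 = 0;
  bip_sum : bip_i1 \c bip_p1 + bip_i2 \c bip_p2 = idm bip_obj
}.

Definition bip_map (C : preadditive_category) (A A' B B' : C)
    (P : biproduct A A') (Q : biproduct B B')
    (f : hom A B) (f' : hom A' B') : hom P Q :=
  bip_i1 Q \c f \c bip_p1 P + bip_i2 Q \c f' \c bip_p2 P.

Definition is_additive (C : preadditive_category) : Prop :=
  (exists Z : C, is_zero_object Z) /\
  (forall A B : C, inhabited (biproduct A B)).

Definition is_iso (C : preadditive_category) (A B : C) (f : hom A B) : Prop :=
  exists g : hom B A, g \c f = idm A /\ f \c g = idm B.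

(** * Abelian categories *)

Definition is_kernel (C : preadditive_category) (K A B : C)
    (k : hom K A) (f : hom A B) : Prop :=
  f \c k = 0 /\
  forall (G : C) (g : hom G A), f \c g = 0 -> exists! u : hom G K, k \c u = g.

Definition is_cokernel (C : preadditive_category) (A B Q : C)
    (f : hom A B) (q : hom B Q) : Prop :=
  q \c f = 0 /\
  forall (G : C) (g : hom B G), g \c f = 0 -> exists! u : hom Q G, u \c q = g.

Definition is_mono (C : preadditive_category) (A B : C) (f : hom A B) : Prop :=
  forall (G : C) (u v : hom G A), f \c u = f \c v -> u = v.

Definition is_epi (C : preadditive_category) (A B : C) (f : hom A B) : Prop :=
  forall (G : C) (u v : hom B G), u \c f = v \c f -> u = v.

Definition is_abelian (C : preadditive_category) : Prop :=
  [/\ is_additive C,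
      forall (A B : C) (f : hom A B), exists (K : C) (k : hom K A), is_kernel k f,
      forall (A B : C) (f : hom A B), exists (Q : C) (q : hom B Q), is_cokernel f q,
      forall (A B : C) (f : hom A B),
        is_mono f -> exists (D : C) (g : hom B D), is_kernel f g
    & forall (A B : C) (f : hom A B),
        is_epi f -> exists (D : C) (g : hom D A), is_cokernel g f].

(** * Extriangulated categories *)

(* [ext D A] is the group of extensions E(D, A), contravariant in [D] and
   covariant in [A]; [push a] and [pull c] are a_* and c^*. *)
Record additive_bifunctor (C : preadditive_category) := AdditiveBifunctor {
  ext :> C -> C -> zmodType;
  push : forall D A A', hom A A' -> ext D A -> ext D A';
  pull : forall D D' A, hom D' D -> ext D A -> ext D' A;
  push1 : forall D A (d : ext D A), push (idm A) d = d;
  pull1 : forall D A (d : ext D A), pull (idm D) d = d;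
  pushM : forall D A A' A'' (a' : hom A' A'') (a : hom A A') (d : ext D A),
    push (a' \c a) d = push a' (push a d);
  pullM : forall D D' D'' A (c : hom D' D) (c' : hom D'' D') (d : ext D A),
    pull (c \c c') d = pull c' (pull c d);
  push_pull : forall D D' A A' (a : hom A A') (c : hom D' D) (d : ext D A),
    push a (pull c d) = pull c (push a d);
  pushD : forall D A A' (a : hom A A') (d d' : ext D A),
    push a (d + d') = push a d + push a d';
  pullD : forall D D' A (c : hom D' D) (d d' : ext D A),
    pull c (d + d') = pull c d + pull c d';
  push_addm : forall D A A' (a b : hom A A') (d : ext D A),
    push (a + b) d = push a d + push b d;
  pull_addm : forall D D' A (c e : hom D' D) (d : ext D A),
    pull (c + e) d = pull c d + pull e d
}.

Arguments push {C a D A A'} _ _ : rename.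
Arguments pull {C a D D' A} _ _ : rename.

Definition ext_sum (C : preadditive_category) (E : additive_bifunctor C)
    (A A' D D' : C) (P : biproduct A A') (Q : biproduct D D')
    (d : E D A) (d' : E D' A') : E Q P :=
  push (bip_i1 P) (pull (bip_p1 Q) d) + push (bip_i2 P) (pull (bip_p2 Q) d').

Record short_seq (C : preadditive_category) (A D : C) := ShortSeq {
  seq_mid : C;
  seq_fst : hom A seq_mid;
  seq_snd : hom seq_mid D
}.

Definition seq_equiv (C : preadditive_category) (A D : C)
    (S S' : short_seq A D) : Prop :=
  exists b : hom (seq_mid S) (seq_mid S'),
    [/\ is_iso b, b \c seq_fst S = seq_fst S' & seq_snd S' \c b = seq_snd S].

(* An equivalence class of sequences is represented by its membership
   predicate. *)
Definition is_seq_class (C : preadditive_category) (A D : C)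
    (cl : short_seq A D -> Prop) : Prop :=
  exists S0, forall S, cl S <-> seq_equiv S0 S.

Record realization (C : preadditive_category) (E : additive_bifunctor C) :=
  Realization {
    realizes : forall (D A : C), E D A -> short_seq A D -> Prop;
    realizes_class : forall (D A : C) (d : E D A), is_seq_class (realizes d);
    realizes_mor : forall (A B D A' B' D' : C)
      (x : hom A B) (y : hom B D) (x' : hom A' B') (y' : hom B' D')
      (d : E D A) (d' : E D' A') (a : hom A A') (c : hom D D'),
      realizes d (ShortSeq x y) -> realizes d' (ShortSeq x' y') ->
      push a d = pull c d' ->
      exists b : hom B B', b \c x = x' \c a /\ y' \c b = c \c y
  }.

Arguments realizes {C E} r {D A} d S : rename.

Definition is_additive_realization (C : preadditive_category)
    (E : additive_bifunctor C) (s : realization E) : Prop :=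
  (forall (A D : C) (P : biproduct A D),
     realizes s (0 : E D A) (ShortSeq (bip_i1 P) (bip_p2 P))) /\
  (forall (A B D A' B' D' : C)
     (P : biproduct A A') (Q : biproduct B B') (R : biproduct D D')
     (x : hom A B) (y : hom B D) (x' : hom A' B') (y' : hom B' D')
     (d : E D A) (d' : E D' A'),
     realizes s d (ShortSeq x y) -> realizes s d' (ShortSeq x' y') ->
     realizes s (ext_sum P R d d')
       (ShortSeq (bip_map P Q x x') (bip_map Q R y y'))).

Definition ET3 (C : preadditive_category) (E : additive_bifunctor C)
    (s : realization E) : Prop :=
  forall (A B D A' B' D' : C)
    (x : hom A B) (y : hom B D) (x' : hom A' B') (y' : hom B' D')
    (d : E D A) (d' : E D' A') (a : hom A A') (b : hom B B'),
    realizes s d (ShortSeq x y) -> realizes s d' (ShortSeq x' y') ->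
    b \c x = x' \c a ->
    exists c : hom D D', c \c y = y' \c b /\ push a d = pull c d'.

Definition ET3op (C : preadditive_category) (E : additive_bifunctor C)
    (s : realization E) : Prop :=
  forall (A B D A' B' D' : C)
    (x : hom A B) (y : hom B D) (x' : hom A' B') (y' : hom B' D')
    (d : E D A) (d' : E D' A') (b : hom B B') (c : hom D D'),
    realizes s d (ShortSeq x y) -> realizes s d' (ShortSeq x' y') ->
    y' \c b = c \c y ->
    exists a : hom A A', b \c x = x' \c a /\ push a d = pull c d'.

Definition ET4 (C : preadditive_category) (E : additive_bifunctor C)
    (s : realization E) : Prop :=
  forall (A B D F G : C)
    (f : hom A B) (f' : hom B D) (g : hom B G) (g' : hom G F)
    (d1 : E D A) (d2 : E F B),
    realizes s d1 (ShortSeq f f') -> realizes s d2 (ShortSeq g g') ->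
    exists (W : C) (h' : hom G W) (d : hom D W) (e : hom W F) (d3 : E W A),
      realizes s d3 (ShortSeq (g \c f) h') /\
      h' \c g = d \c f' /\
      e \c h' = g' /\
      realizes s (push f' d2) (ShortSeq d e) /\
      pull d d3 = d1 /\
      push f d3 = pull e d2.

(* Obtained from [ET4] by reversing every arrow and exchanging push and pull:
   D -f'-> B -f-> A realizes d1 and F -g'-> G -g-> B realizes d2. *)
Definition ET4op (C : preadditive_category) (E : additive_bifunctor C)
    (s : realization E) : Prop :=
  forall (A B D F G : C)
    (f : hom B A) (f' : hom D B) (g : hom G B) (g' : hom F G)
    (d1 : E A D) (d2 : E B F),
    realizes s d1 (ShortSeq f' f) -> realizes s d2 (ShortSeq g' g) ->
    exists (W : C) (h' : hom W G) (d : hom W D) (e : hom F W) (d3 : E A W),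
      realizes s d3 (ShortSeq h' (f \c g)) /\
      g \c h' = f' \c d /\
      h' \c e = g' /\
      realizes s (pull f' d2) (ShortSeq e d) /\
      push d d3 = d1 /\
      pull f d3 = push e d2.

Record extriangulated_category := ExtriangulatedCategory {
  ecat :> preadditive_category;
  eext : additive_bifunctor ecat;
  ereal : realization eext;
  ecat_additive : is_additive ecat;
  ereal_additive : is_additive_realization ereal;
  ecat_ET3 : ET3 ereal;
  ecat_ET3op : ET3op ereal;
  ecat_ET4 : ET4 ereal;
  ecat_ET4op : ET4op ereal
}.

Record etriangle (C : extriangulated_category) (A B D : C) := ETriangle {
  tri_inf : hom A B;
  tri_def : hom B D;
  tri_ext : eext C D A;
  tri_real : realizes (ereal C) tri_ext (ShortSeq tri_inf tri_def)
}.

Definition is_etriangle_mor (C : extriangulated_category) (A B D A' B' D' : C)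
    (t : etriangle A B D) (t' : etriangle A' B' D')
    (a : hom A A') (b : hom B B') (c : hom D D') : Prop :=
  [/\ b \c tri_inf t = tri_inf t' \c a,
      tri_def t' \c b = c \c tri_def t
    & push a (tri_ext t) = pull c (tri_ext t')].

Definition splits (C : extriangulated_category) (A B D : C)
    (t : etriangle A B D) : Prop :=
  tri_ext t = 0.

(** * Subcategories and approximations *)

(* A full subcategory, given by its class of objects; it is not required to be
   closed under isomorphisms. *)
Definition subcategory (C : preadditive_category) := C -> Prop.

Definition sum_closed (C : preadditive_category) (X : subcategory C) : Prop :=
  (exists Z : C, X Z /\ is_zero_object Z) /\
  (forall A B : C, X A -> X B -> exists P : biproduct A B, X P).

Definition left_approximation (C : preadditive_category) (X : subcategory C)
    (A B : C) (f : hom A B) : Prop :=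
  X B /\ forall (M : C) (g : hom A M), X M -> exists h : hom B M, h \c f = g.

Definition right_approximation (C : preadditive_category) (X : subcategory C)
    (A B : C) (f : hom A B) : Prop :=
  X A /\ forall (M : C) (g : hom M B), X M -> exists h : hom M A, f \c h = g.

Definition pseudo_cluster_tilting (C : extriangulated_category)
    (X : subcategory C) : Prop :=
  (forall A : C, exists (X1 X2 : C) (t : etriangle A X1 X2),
     [/\ X X1, X X2 & left_approximation X (tri_inf t)]) /\
  (forall A : C, exists (X3 X4 : C) (t : etriangle X3 X4 A),
     [/\ X X3, X X4 & right_approximation X (tri_def t)]).

(** * The quotient category C/X *)

Definition factors_through (C : preadditive_category) (X : subcategory C)
    (A B : C) (f : hom A B) : Prop :=
  exists (M : C) (g : hom A M) (h : hom M B), X M /\ f = h \c g.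

Lemma comp0m (C : preadditive_category) (A B D : C) (f : hom A B) :
  (0 : hom B D) \c f = 0.
Proof. by apply: (addrI ((0 : hom B D) \c f)); rewrite -compDl !addr0. Qed.

Lemma compm0 (C : preadditive_category) (A B D : C) (g : hom B D) :
  g \c (0 : hom A B) = 0.
Proof. by apply: (addrI (g \c (0 : hom A B))); rewrite -compDr !addr0. Qed.

Lemma compNl (C : preadditive_category) (A B D : C) (g : hom B D) (f : hom A B) :
  (- g) \c f = - (g \c f).
Proof. by apply: (addrI (g \c f)); rewrite -compDl !subrr comp0m. Qed.

Lemma compNr (C : preadditive_category) (A B D : C) (g : hom B D) (f : hom A B) :
  g \c (- f) = - (g \c f).
Proof. by apply: (addrI (g \c f)); rewrite -compDr !subrr compm0. Qed.

(* X(A, B) as a boolean predicate. The proof of [sum_closed X], not used in the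
   definition, makes it a subgroup of [hom A B] and so allows the quotient. *)
Definition hom_ideal (C : preadditive_category) (X : subcategory C)
    (hX : sum_closed X) (A B : C) : {pred hom A B} :=
  fun f => `[< factors_through X f >].

Lemma hom_ideal_closed (C : preadditive_category) (X : subcategory C)
    (hX : sum_closed X) (A B : C) : zmod_closed (hom_ideal hX (A := A) (B := B)).
Proof.
split=> [|f f' /asboolP [M [g [h [XM ->]]]] /asboolP [M' [g' [h' [XM' ->]]]]];
  apply/asboolP.
  have [[Z [XZ _]] _] := hX.
  by exists Z, 0, 0; rewrite comp0m.
have [P XP] := hX.2 _ _ XM XM'.
exists P, (bip_i1 P \c g + bip_i2 P \c g'), (h \c bip_p1 P - h' \c bip_p2 P).
split=> //; rewrite compDl !compDr !compNl -!compA.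
rewrite [bip_p1 P \c (_ \c g)]compA [bip_p2 P \c (_ \c g')]compA.
rewrite [bip_p1 P \c (_ \c g')]compA [bip_p2 P \c (_ \c g)]compA.
by rewrite !(bip_p1i1, bip_p2i2, bip_p1i2, bip_p2i1) !comp1m !comp0m !compm0 oppr0
  addr0 add0r.
Qed.

HB.instance Definition _ (C : preadditive_category) (X : subcategory C)
    (hX : sum_closed X) (A B : C) :=
  GRing.isZmodClosed.Build (hom A B) (@hom_ideal C X hX A B)
    (@hom_ideal_closed C X hX A B).

Definition quot_hom (C : preadditive_category) (X : subcategory C)
    (hX : sum_closed X) (A B : C) : zmodType :=
  Quotient.quot (@hom_ideal C X hX A B).

Definition quot_pi (C : preadditive_category) (X : subcategory C)
    (hX : sum_closed X) (A B : C) (f : hom A B) : quot_hom hX A B :=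
  \pi_(Quotient.quot (@hom_ideal C X hX A B)) f.

Definition quot_repr (C : preadditive_category) (X : subcategory C)
    (hX : sum_closed X) (A B : C) (f : quot_hom hX A B) : hom A B :=
  repr (f : Quotient.quot (@hom_ideal C X hX A B)).

Definition quot_comp (C : preadditive_category) (X : subcategory C)
    (hX : sum_closed X) (A B D : C)
    (g : quot_hom hX B D) (f : quot_hom hX A B) : quot_hom hX A D :=
  quot_pi hX (quot_repr g \c quot_repr f).

Lemma quot_reprK (C : preadditive_category) (X : subcategory C)
    (hX : sum_closed X) (A B : C) (f : quot_hom hX A B) :
  quot_pi hX (quot_repr f) = f.
Proof. exact: (reprK (f : Quotient.quot (@hom_ideal C X hX A B))). Qed.

Lemma quot_piD (C : preadditive_category) (X : subcategory C)
    (hX : sum_closed X) (A B : C) (f f' : hom A B) :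
  quot_pi hX (f + f') = quot_pi hX f + quot_pi hX f'.
Proof. exact: (raddfD \pi_(Quotient.quot (@hom_ideal C X hX A B))). Qed.

Lemma quot_piP (C : preadditive_category) (X : subcategory C)
    (hX : sum_closed X) (A B : C) (f f' : hom A B) :
  quot_pi hX f = quot_pi hX f' <-> factors_through X (f - f').
Proof.
rewrite /quot_pi; split=> [/eqP|ff'].
  by rewrite -Quotient.idealrBE => /asboolP.
by apply/eqP; rewrite -Quotient.idealrBE; apply/asboolP.
Qed.

Lemma quot_piM (C : preadditive_category) (X : subcategory C)
    (hX : sum_closed X) (A B D : C) (g : hom B D) (f : hom A B) :
  quot_pi hX (g \c f) = quot_comp (quot_pi hX g) (quot_pi hX f).
Proof.
rewrite /quot_comp; set g' := quot_repr _; set f' := quot_repr _.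
have [M [u [v [XM e]]]] : factors_through X (g - g').
  by apply/(quot_piP hX); rewrite quot_reprK.
have [N [u' [v' [XN e']]]] : factors_through X (f - f').
  by apply/(quot_piP hX); rewrite quot_reprK.
have -> : quot_pi hX (g \c f) = quot_pi hX (g' \c f).
  apply/quot_piP; exists M, (u \c f), v; split=> //.
  by rewrite compA -e compDl compNl.
apply/quot_piP; exists N, u', (g' \c v'); split=> //.
by rewrite -compA -e' compDr compNr.
Qed.

Section QuotientLaws.
Variables (C : preadditive_category) (X : subcategory C) (hX : sum_closed X).

Lemma quot_compA (A B D F : C) (h : quot_hom hX D F) (g : quot_hom hX B D)
    (f : quot_hom hX A B) :
  quot_comp h (quot_comp g f) = quot_comp (quot_comp h g) f.
Proof.
rewrite -[h]quot_reprK -[g]quot_reprK -[f]quot_reprK -!quot_piM.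
by rewrite compA.
Qed.

Lemma quot_comp1m (A B : C) (f : quot_hom hX A B) :
  quot_comp (quot_pi hX (idm B)) f = f.
Proof. by rewrite -[f]quot_reprK -quot_piM comp1m. Qed.

Lemma quot_compm1 (A B : C) (f : quot_hom hX A B) :
  quot_comp f (quot_pi hX (idm A)) = f.
Proof. by rewrite -[f]quot_reprK -quot_piM compm1. Qed.

Lemma quot_compDl (A B D : C) (g g' : quot_hom hX B D) (f : quot_hom hX A B) :
  quot_comp (g + g') f = quot_comp g f + quot_comp g' f.
Proof.
rewrite -[g]quot_reprK -[g']quot_reprK -[f]quot_reprK.
by rewrite -quot_piD -!quot_piM -quot_piD compDl.
Qed.

Lemma quot_compDr (A B D : C) (g : quot_hom hX B D) (f f' : quot_hom hX A B) :
  quot_comp g (f + f') = quot_comp g f + quot_comp g f'.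
Proof.
rewrite -[g]quot_reprK -[f]quot_reprK -[f']quot_reprK.
by rewrite -quot_piD -!quot_piM -quot_piD compDr.
Qed.

End QuotientLaws.

Definition quotient_category (C : preadditive_category) (X : subcategory C)
    (hX : sum_closed X) : preadditive_category :=
  @PreadditiveCategory C (quot_hom hX) (fun A => quot_pi hX (idm A))
    (@quot_comp C X hX) (@quot_compA C X hX)
    (@quot_comp1m C X hX) (@quot_compm1 C X hX)
    (@quot_compDl C X hX) (@quot_compDr C X hX).

(** * Relative exactness and self-orthogonality *)

(* Exactness of U -f-> V -g-> W -> 0 in abelian groups. *)
Definition right_exact_seq (U V W : zmodType) (f : U -> V) (g : V -> W) : Prop :=
  (forall v, g v = 0 <-> exists u, f u = v) /\ (forall w, exists v, g v = w).

(* C(X, -)-exact *)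
Definition cov_exact (C : extriangulated_category) (X : subcategory C)
    (A B D : C) (t : etriangle A B D) : Prop :=
  forall M : C, X M ->
    right_exact_seq (fun u : hom M A => tri_inf t \c u)
                    (fun v : hom M B => tri_def t \c v).

(* C(-, X)-exact *)
Definition contra_exact (C : extriangulated_category) (X : subcategory C)
    (A B D : C) (t : etriangle A B D) : Prop :=
  forall M : C, X M ->
    right_exact_seq (fun u : hom D M => u \c tri_def t)
                    (fun v : hom B M => v \c tri_inf t).

Definition etriangle_class (C : extriangulated_category) :=
  forall A B D : C, etriangle A B D -> Prop.

Definition class_S (C : extriangulated_category) (X : subcategory C) :
    etriangle_class C :=
  fun S1 S2 S3 t =>
    exists (U M1 M2 : C)
      (r1 : etriangle U S1 M1) (r2 : etriangle U S2 M2) (c2 : etriangle M1 M2 S3),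
      [/\ is_etriangle_mor r1 r2 (idm U) (tri_inf t) (tri_inf c2),
          is_etriangle_mor t c2 (tri_def r1) (tri_def r2) (idm S3),
          cov_exact X r2
        & contra_exact X c2].

Definition class_T (C : extriangulated_category) (X : subcategory C) :
    etriangle_class C :=
  fun T1 T2 T3 t =>
    exists (N2 N3 V : C)
      (r1 : etriangle T1 N2 N3) (c1 : etriangle N2 T2 V) (c2 : etriangle N3 T3 V),
      [/\ is_etriangle_mor r1 t (idm T1) (tri_inf c1) (tri_inf c2),
          is_etriangle_mor c1 c2 (tri_def r1) (tri_def t) (idm V),
          contra_exact X c1
        & cov_exact X r1].

Definition self_orthogonal (C : extriangulated_category) (X : subcategory C)
    (Y : etriangle_class C) : Prop :=
  forall (A B D : C) (t : etriangle A B D), Y A B D t -> X A -> X D -> splits t.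

(* Main.v *)
From mathcomp Require Import all_boot all_algebra.
From mathcomp Require Import boolp.
Require Import Defs.

Set Implicit Arguments.
Unset Strict Implicit.
Unset Printing Implicit Defensive.

Import GRing.Theory.
Local Open Scope ring_scope.

(** Each of the three conditions holds if and only if the quotient category C/X
    is balanced, that is, every morphism that is both mono and epi is invertible
    ([quot_abelian_iff_balanced], [orthogonal_balanced],
    [dual_orthogonal_balanced]).  Since a morphism vanishes in C/X exactly when
    it factors through an object of X, everything can be phrased by morphisms of
    C and the ideal of X: the suffix [mod] marks such a phrase.

    Kernels always exist in C/X.  Given f : A -> B, pull the triangle
    X3 -> X4 -> B of a right approximation back along f to X3 -> K -> A.  A map
    into A lifts to K as soon as its composite with f factors through X, because
    such a composite lifts to X4 and so kills the pulled-back extension.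
    Cokernels are dual, so C/X is abelian as soon as monos are kernels and epis
    are cokernels; and a preadditive category where monos are kernels is
    balanced, since an epi kernel of g forces g = 0.

    The bridge between balance and self-orthogonality is the condition
    [monic_inflations_split]: a C(-,X)-exact triangle M1 -> M2 -> S3 with S3 in X
    splits as soon as its inflation is mono in C/X.

    It makes monos kernels.  If f : A -> B is mono in C/X, a left approximation
    x : A -> X1 yields an inflation (x, f) : A -> X1 (+) B with a cone W.  Pulling
    a right approximation X4 -> W back along X1 (+) B -> W gives an object E that
    is the kernel of B -> W in C/X, and a triangle A -> E -> X4 to which the
    condition applies; its splitting identifies A with E in C/X.

    It follows from balance, as its inflation is also epi in C/X by exactness.

    It implies orthogonality for S.  In the diagram defining S, if S1 is in X, a
    map G -> M1 whose composite with M1 -> M2 factors through X lifts to S1, so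
    M1 -> M2 is mono in C/X.  The resulting section of M2 -> S3 lifts to S2 by
    C(X,-)-exactness, and the given triangle splits.

    It follows from orthogonality for S.  Applying (ET4)^op to M1 -> M2 -> S3 and
    to a right approximation X3 -> X4 -> M2 gives a triangle K -> X4 -> S3 in S,
    where K is the kernel of M1 -> M2 in C/X and hence zero there.  Such a K is
    only a summand of an object of X, and X need not be closed under summands or
    isomorphisms; but the left approximation K -> X5 -> X6 splits, so adding X6
    to the first two terms replaces K by X5 itself and orthogonality applies.

    The class T for C is the class S for the opposite extriangulated category,
    and balance is self-dual. *)

(** * Additive preliminaries *)

Lemma compBl (C : preadditive_category) (A B D : C) (g g' : hom B D)
    (f : hom A B) : (g - g') \c f = g \c f - g' \c f.
Proof. by rewrite compDl compNl. Qed.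

Lemma compBr (C : preadditive_category) (A B D : C) (g : hom B D)
    (f f' : hom A B) : g \c (f - f') = g \c f - g \c f'.
Proof. by rewrite compDr compNr. Qed.

Definition bip_swap (C : preadditive_category) (A B : C) (P : biproduct A B) :
  biproduct B A :=
  Biproduct (bip_p2i2 P) (bip_p1i1 P) (bip_p2i1 P) (bip_p1i2 P)
    (etrans (addrC _ _) (bip_sum P)).

(** Taking [A] itself as the carrier of the sum of [A] and zero lets a trivial
    sequence be added while one of the terms stays literally the same object. *)
Definition bip_zero (C : preadditive_category) (A Z : C)
    (hZ : is_zero_object Z) : biproduct A Z.
Proof.
refine (@Biproduct C A Z A (idm A) 0 (idm A) 0 _ _ _ _ _).
- exact: comp1m.
- by rewrite comp0m (hZ.2 _ (idm Z)).
- exact: compm0.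
- exact: comp0m.
- by rewrite comp1m compm0 addr0.
Defined.

(** Makes the graph of [f] the first summand of [P], so that additivity realizes
    the split sequence of that graph on the same middle term. *)
Definition bip_shear (C : preadditive_category) (A B : C) (P : biproduct A B)
    (f : hom A B) : biproduct A B.
Proof.
refine (@Biproduct C A B P (bip_i1 P + bip_i2 P \c f) (bip_i2 P) (bip_p1 P)
  (bip_p2 P - f \c bip_p1 P) _ _ _ _ _).
- by rewrite compDr compA bip_p1i1 bip_p1i2 comp0m addr0.
- by rewrite compBl -compA bip_p1i2 bip_p2i2 compm0 subr0.
- exact: bip_p1i2.
- rewrite compBl !compDr compA bip_p2i1 bip_p2i2 comp1m add0r -!compA.
  by rewrite bip_p1i1 [bip_p1 P \c _]compA bip_p1i2 comp0m compm0 addr0 compm1 subrr.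
- rewrite compDl compBr -[RHS](bip_sum P) -addrA; congr (_ + _).
  by rewrite -!compA addrC subrK.
Defined.

Lemma bip_map_i1 (C : preadditive_category) (A A' B B' : C)
    (P : biproduct A A') (Q : biproduct B B') (f : hom A B) (f' : hom A' B') :
  bip_map P Q f f' \c bip_i1 P = bip_i1 Q \c f.
Proof. by rewrite /bip_map compDl -!compA bip_p1i1 bip_p2i1 !compm0 addr0 compm1. Qed.

Lemma bip_map_i2 (C : preadditive_category) (A A' B B' : C)
    (P : biproduct A A') (Q : biproduct B B') (f : hom A B) (f' : hom A' B') :
  bip_map P Q f f' \c bip_i2 P = bip_i2 Q \c f'.
Proof. by rewrite /bip_map compDl -!compA bip_p1i2 bip_p2i2 !compm0 add0r compm1. Qed.

Lemma bip_map_p1 (C : preadditive_category) (A A' B B' : C)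
    (P : biproduct A A') (Q : biproduct B B') (f : hom A B) (f' : hom A' B') :
  bip_p1 Q \c bip_map P Q f f' = f \c bip_p1 P.
Proof. by rewrite /bip_map compDr !compA bip_p1i1 bip_p1i2 !comp0m addr0 comp1m. Qed.

Lemma bip_map_comp (C : preadditive_category) (A A' B B' D D' : C)
    (P : biproduct A A') (Q : biproduct B B') (R : biproduct D D')
    (g : hom B D) (g' : hom B' D') (f : hom A B) (f' : hom A' B') :
  bip_map Q R g g' \c bip_map P Q f f' = bip_map P R (g \c f) (g' \c f').
Proof.
rewrite [bip_map P Q f f']/bip_map compDr !compA bip_map_i1 bip_map_i2.
by rewrite /bip_map !compA.
Qed.

(** * The opposite extriangulated category *)

Definition opp_cat (C : preadditive_category) : preadditive_category :=
  @PreadditiveCategory C (fun A B => hom B A) (fun A => idm A)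
    (fun A B D g f => f \c g)
    (fun A B D F h g f => esym (compA f g h))
    (fun A B f => compm1 f) (fun A B f => comp1m f)
    (fun A B D g g' f => compDr f g g') (fun A B D g f f' => compDl f f' g).

(** Duality exchanges the injections and the projections. *)
Definition unopp_bip (C : preadditive_category) (A B : C)
    (P : @biproduct (opp_cat C) A B) : biproduct A B :=
  @Biproduct C A B (bip_obj P) (bip_p1 P) (bip_p2 P) (bip_i1 P) (bip_i2 P)
    (bip_p1i1 P) (bip_p2i2 P) (bip_p2i1 P) (bip_p1i2 P) (bip_sum P).

Definition opp_bip (C : preadditive_category) (A B : C) (P : biproduct A B) :
  @biproduct (opp_cat C) A B :=
  @Biproduct (opp_cat C) A B (bip_obj P) (bip_p1 P) (bip_p2 P) (bip_i1 P)
    (bip_i2 P) (bip_p1i1 P) (bip_p2i2 P) (bip_p2i1 P) (bip_p1i2 P) (bip_sum P).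

Definition opp_ext (C : preadditive_category) (E : additive_bifunctor C) :
    additive_bifunctor (opp_cat C) :=
  @AdditiveBifunctor (opp_cat C) (fun D A => E A D)
    (fun D A A' a d => pull (a : @hom C A' A) d)
    (fun D D' A c d => push (c : @hom C D D') d)
    (fun D A d => pull1 d) (fun D A d => push1 d)
    (fun D A A' A'' a' a d => pullM (a : @hom C A' A) (a' : @hom C A'' A') d)
    (fun D D' D'' A c c' d =>
       pushM (c' : @hom C D' D'') (c : @hom C D D') d)
    (fun D D' A A' a c d =>
       esym (push_pull (c : @hom C D D') (a : @hom C A' A) d))
    (fun D A A' a d d' => pullD (a : @hom C A' A) d d')
    (fun D D' A c d d' => pushD (c : @hom C D D') d d')
    (fun D A A' a b d => pull_addm (a : @hom C A' A) b d)
    (fun D D' A c e d => push_addm (c : @hom C D D') e d).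

Definition opp_seq (C : preadditive_category) (A D : C)
    (S : @short_seq (opp_cat C) A D) : @short_seq C D A :=
  @ShortSeq C D A (seq_mid S) (seq_snd S) (seq_fst S).

Lemma seq_equiv_sym (C : preadditive_category) (A D : C)
    (S S' : short_seq A D) : seq_equiv S S' -> seq_equiv S' S.
Proof.
case=> b [[c [cb bc]] bS Sb]; exists c; split; first by exists b.
  by rewrite -bS compA cb comp1m.
by rewrite -Sb -compA bc compm1.
Qed.

Lemma seq_equiv_trans (C : preadditive_category) (A D : C)
    (S S' S'' : short_seq A D) :
  seq_equiv S S' -> seq_equiv S' S'' -> seq_equiv S S''.
Proof.
case=> b [[b' [bb' b'b]] bS Sb] [c [[c' [cc' c'c]] cS Sc]].
exists (c \c b); split.
- exists (b' \c c'); split.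
    by rewrite compA -(compA b') cc' compm1.
  by rewrite compA -(compA c) b'b compm1.
- by rewrite -compA bS.
- by rewrite compA Sc.
Qed.

Lemma opp_seq_equiv (C : preadditive_category) (A D : C)
    (S S' : @short_seq (opp_cat C) A D) :
  seq_equiv (opp_seq S) (opp_seq S') <-> seq_equiv S S'.
Proof.
split=> [/seq_equiv_sym|e]; last apply: seq_equiv_sym; last move: e.
all: by case=> b [[c [cb bc]] bS Sb]; exists b; split=> //; exists c.
Qed.

Definition opp_real (C : preadditive_category) (E : additive_bifunctor C)
    (s : realization E) : realization (opp_ext E).
Proof.
refine (@Realization (opp_cat C) (opp_ext E)
  (fun D A d S => @realizes C E s A D d (opp_seq S)) _ _).
- move=> D A d; have [S0 hS0] := @realizes_class C E s A D d.
  exists (@ShortSeq (opp_cat C) A D (seq_mid S0) (seq_snd S0) (seq_fst S0)) => S.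
  rewrite (hS0 (opp_seq S)) -opp_seq_equiv.
  by case: S0 {hS0}.
- move=> A B D A' B' D' x y x' y' d d' a c r r' e.
  by have [b [bx yb]] := @realizes_mor C E s _ _ _ _ _ _ _ _ _ _ _ _ _ _ r' r (esym e);
    exists b.
Defined.

Lemma opp_additive (C : preadditive_category) :
  is_additive C -> is_additive (opp_cat C).
Proof.
case=> -[Z [Z1 Z2]] bip; split; first by exists Z; split=> A f; [apply: Z2|apply: Z1].
by move=> A B; have [P] := bip A B; exists; apply: opp_bip.
Qed.

Lemma opp_additive_real (C : preadditive_category) (E : additive_bifunctor C)
    (s : realization E) :
  is_additive_realization s -> is_additive_realization (opp_real s).
Proof.
case=> s0 sD; split=> [A D P|A B D A' B' D' P Q R x y x' y' d d' r r'].
  exact: (s0 D A (bip_swap (unopp_bip P))).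
have := sD _ _ _ _ _ _ (unopp_bip R) (unopp_bip Q) (unopp_bip P)
  _ _ _ _ _ _ r r'.
rewrite /= /ext_sum /bip_map /= /opp_seq /= !push_pull.
by rewrite -!compA.
Qed.

Definition opp_extri (C : extriangulated_category) : extriangulated_category.
Proof.
refine (@ExtriangulatedCategory (opp_cat C) (opp_ext (eext C))
  (opp_real (ereal C)) (opp_additive (ecat_additive C))
  (opp_additive_real (ereal_additive C)) _ _ _ _).
- move=> A B D A' B' D' x y x' y' d d' a b r r' e.
  have [c [e1 e2]] := @ecat_ET3op C _ _ _ _ _ _ _ _ _ _ _ _ b a r' r e.
  by exists c.
- move=> A B D A' B' D' x y x' y' d d' b c r r' e.
  have [a [e1 e2]] := @ecat_ET3 C _ _ _ _ _ _ _ _ _ _ _ _ c b r' r e.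
  by exists a.
- move=> A B D F G f f' g g' d1 d2 r r'.
  exact: (@ecat_ET4op C A B D F G f f' g g' d1 d2 r r').
- move=> A B D F G f f' g g' d1 d2 r r'.
  exact: (@ecat_ET4 C A B D F G f f' g g' d1 d2 r r').
Defined.

(** * Exactness of the sequences of an E-triangle *)

Section Exactness.
Variable C : extriangulated_category.
Implicit Types A B D G : C.

Lemma push0m D A A' (d : eext C D A) : push (0 : hom A A') d = 0.
Proof. by apply: (addrI (push (0 : hom A A') d)); rewrite -push_addm !addr0. Qed.

Lemma pushm0 D A A' (a : hom A A') : push a (0 : eext C D A) = 0.
Proof. by apply: (addrI (push a 0)); rewrite -pushD !addr0. Qed.

Lemma pullm0 D D' A (c : hom D' D) : pull c (0 : eext C D A) = 0.
Proof. by apply: (addrI (pull c 0)); rewrite -pullD !addr0. Qed.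

Lemma realization_exists D A (d : eext C D A) :
  exists B (x : hom A B) (y : hom B D), realizes (ereal C) d (ShortSeq x y).
Proof.
have [[B x y] hS] := realizes_class (ereal C) d.
exists B, x, y; apply/hS; exists (idm B).
by split; rewrite ?comp1m ?compm1 //; exists (idm B); rewrite comp1m.
Qed.

Lemma realizes_equiv D A (d : eext C D A) (S S' : short_seq A D) :
  realizes (ereal C) d S -> seq_equiv S S' -> realizes (ereal C) d S'.
Proof.
have [S0 hS] := realizes_class (ereal C) d.
by move=> /hS e e'; apply/hS; apply: seq_equiv_trans e'.
Qed.

Lemma realizes_unique D A (d : eext C D A) (S S' : short_seq A D) :
  realizes (ereal C) d S -> realizes (ereal C) d S' -> seq_equiv S S'.
Proof.
have [S0 hS] := realizes_class (ereal C) d.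
by move=> /hS /seq_equiv_sym e /hS; apply: seq_equiv_trans.
Qed.

(** The trivial triangle on the identity: comparing it with another triangle by
    (ET3) or (ET3)^op yields the exactness properties below. *)
Lemma realizes_id_zero A Z : is_zero_object Z ->
  realizes (ereal C) (0 : eext C Z A) (ShortSeq (idm A) 0).
Proof. by move=> hZ; apply: ((ereal_additive C).1 _ _ (bip_zero A hZ)). Qed.

Section Triangle.
Variables (A B D : C) (x : hom A B) (y : hom B D) (d : eext C D A).
Hypothesis r : realizes (ereal C) d (ShortSeq x y).

Lemma triangle_comp0 : y \c x = 0.
Proof.
have [Z hZ] := (ecat_additive C).1.
have [|c [<- _]] := ecat_ET3 (a := idm A) (b := x) (realizes_id_zero A hZ) r.
  by [].
exact: compm0.
Qed.

Lemma triangle_push0 : push x d = 0.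
Proof.
have [Z hZ] := (ecat_additive C).1.
have [|c [_ ->]] := ecat_ET3 (a := x) (b := idm B) r (realizes_id_zero B hZ).
  by [].
exact: pullm0.
Qed.

Lemma triangle_weak_kernel G (g : hom G B) :
  y \c g = 0 -> exists h, g = x \c h.
Proof.
move=> yg; have [Z hZ] := (ecat_additive C).1.
have [|h [e _]] := ecat_ET3op (b := g) (c := 0) (realizes_id_zero G hZ) r.
  by rewrite yg comp0m.
by exists h; rewrite -e compm1.
Qed.

(** A vanishing [pull g d] is realized by a biproduct of [A] and [G], on whose
    summand [G] the induced map to [B] is the lift. *)
Lemma triangle_lift G (g : hom G D) :
  pull g d = 0 -> exists h, g = y \c h.
Proof.
move=> gd; have [P] := (ecat_additive C).2 A G.
have [|b [_ e]] := realizes_mor (a := idm A) (c := g)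
    ((ereal_additive C).1 _ _ P) r.
  by rewrite pushm0 gd.
by exists (b \c bip_i2 P); rewrite compA e -compA bip_p2i2 compm1.
Qed.

End Triangle.
End Exactness.

Section DualExactness.
Variables (C : extriangulated_category) (A B D : C).
Variables (x : hom A B) (y : hom B D) (d : eext C D A).
Hypothesis r : realizes (ereal C) d (ShortSeq x y).

Let ropp : @realizes _ _ (ereal (opp_extri C)) A D d
  (@ShortSeq (opp_cat C) D A B y x) := r.

Lemma triangle_pull0 : pull y d = 0.
Proof. exact: triangle_push0 ropp. Qed.

Lemma triangle_weak_cokernel (G : C) (g : hom B G) :
  g \c x = 0 -> exists h, g = h \c y.
Proof. exact: (@triangle_weak_kernel _ _ _ _ _ _ _ ropp G g). Qed.

Lemma triangle_extend (G : C) (g : hom A G) :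
  push g d = 0 -> exists h, g = h \c x.
Proof. exact: (@triangle_lift _ _ _ _ _ _ _ ropp G g). Qed.

End DualExactness.

(** * Constructions of E-triangles *)

Section Constructions.
Variable C : extriangulated_category.
Implicit Types A B D M G W Y : C.

Lemma is_iso_square_zero A (n : hom A A) : n \c n = 0 -> is_iso (idm A + n).
Proof.
move=> nn; exists (idm A - n); split.
  by rewrite compBl comp1m compDr compm1 nn addr0 addrK.
by rewrite compDl comp1m compBr compm1 nn subr0 subrK.
Qed.

Lemma is_iso_two_sided A B (b : hom A B) (c : hom B A) :
  is_iso (c \c b) -> is_iso (b \c c) -> is_iso b.
Proof.
move=> [l [lcb _]] [m [_ bcm]]; exists (l \c c); split; first by rewrite -compA.
have -> : l \c c = c \c m.
  transitivity (l \c c \c (b \c c \c m)); first by rewrite bcm compm1.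
  by rewrite !compA -(compA l) lcb comp1m.
by rewrite compA.
Qed.

(** A self-map of a short sequence that is the identity on both ends differs
    from the identity by an endomorphism of square zero. *)
Lemma triangle_end_iso A B D (x : hom A B) (y : hom B D) (d : eext C D A)
    (b : hom B B) :
  realizes (ereal C) d (ShortSeq x y) -> b \c x = x -> y \c b = y -> is_iso b.
Proof.
move=> r bx yb; rewrite -[b](subrK (idm B)) addrC; apply: is_iso_square_zero.
have [|t e] := triangle_weak_cokernel r (g := b - idm B).
  by rewrite compBl bx comp1m subrr.
by rewrite {1}e -compA compBr yb compm1 subrr compm0.
Qed.

(** Comparison maps between a realization of [pull c d] and that of [d], in both
    directions, compose to self-maps that fix the ends, hence are invertible. *)
Lemma triangle_iso_cone A B D D' (x : hom A B) (y : hom B D) (d : eext C D A)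
    (c : hom D' D) (c' : hom D D') :
  c' \c c = idm D' -> c \c c' = idm D ->
  realizes (ereal C) d (ShortSeq x y) ->
  realizes (ereal C) (pull c d) (ShortSeq x (c' \c y)).
Proof.
move=> c'c cc' r.
have [B' [x' [y' r']]] := realization_exists (pull c d).
have [|b [bx yb]] := realizes_mor (a := idm A) (c := c) r' r; first by rewrite push1.
have [|b' [b'x yb']] := realizes_mor (a := idm A) (c := c') r r'.
  by rewrite push1 -pullM cc' pull1.
rewrite compm1 in bx; rewrite compm1 in b'x.
apply: (realizes_equiv r'); exists b; split=> //=; last first.
  by rewrite -compA yb compA c'c comp1m.
apply: (is_iso_two_sided (c := b')).
  apply: (triangle_end_iso r'); first by rewrite -compA bx.
  by rewrite compA yb' -compA yb compA c'c comp1m.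
apply: (triangle_end_iso r); first by rewrite -compA b'x.
by rewrite compA yb -compA yb' compA cc' comp1m.
Qed.

Lemma triangle_add_id A B D Y (P : biproduct A Y) (Q : biproduct B Y)
    (x : hom A B) (y : hom B D) (d : eext C D A) :
  realizes (ereal C) d (ShortSeq x y) ->
  realizes (ereal C) (push (bip_i1 P) d)
    (ShortSeq (bip_map P Q x (idm Y)) (y \c bip_p1 Q)).
Proof.
move=> r; have [Z hZ] := (ecat_additive C).1.
have := (ereal_additive C).2 _ _ _ _ _ _ P Q (bip_zero D hZ) _ _ _ _ _ _
  r (realizes_id_zero Y hZ).
rewrite /ext_sum /= pull1 pullm0 pushm0 addr0.
by rewrite /bip_map /= !comp0m addr0 comp1m.
Qed.

(** [M] plays the part of the pullback, over [D], of the middle terms of the two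
    triangles that realize [d1] and [d2].  (ET4), applied to the split inclusion
    of [A1] in [P] and to [g], presents the quotient of [M] by [A1] as a
    realization of [d2], that is, as [B2]. *)
Lemma sum_realization_quotient A1 A2 B2 D (P : biproduct A1 A2) M
    (g : hom P M) (g' : hom M D) (x2 : hom A2 B2) (y2 : hom B2 D)
    (d1 : eext C D A1) (d2 : eext C D A2) :
  realizes (ereal C) d2 (ShortSeq x2 y2) ->
  realizes (ereal C) (push (bip_i1 P) d1 + push (bip_i2 P) d2)
    (ShortSeq g g') ->
  exists e2 : hom M B2,
    realizes (ereal C) (pull y2 d1) (ShortSeq (g \c bip_i1 P) e2) /\
    e2 \c (g \c bip_i2 P) = x2.
Proof.
move=> r2 r.
have [W [h [d [e [d3 [r3 [hg [_ [rW [_ d3e]]]]]]]]]] :=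
  ecat_ET4 ((ereal_additive C).1 _ _ P) r.
have ed3 : d3 = pull e d1.
  rewrite -[d3]push1 -(bip_p1i1 P) pushM d3e push_pull pushD -!pushM.
  by rewrite bip_p1i1 bip_p1i2 push1 push0m addr0.
have [b [[c [cb bc]] /= bd eb]] : seq_equiv (ShortSeq d e) (ShortSeq x2 y2).
  apply: realizes_unique r2.
  rewrite -[d2]push1 -(bip_p2i2 P) -[push _ _]add0r -(push0m A2 d1).
  by rewrite -(bip_p2i1 P) !pushM -pushD.
exists (b \c h); split.
- have -> : pull y2 d1 = pull c d3 by rewrite ed3 -pullM -eb -compA bc compm1.
  exact: triangle_iso_cone r3.
- by rewrite -compA [h \c _]compA hg -compA bip_p2i2 compm1.
Qed.

(** The realization of the sum of the two extensions is used twice, with the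
    roles of the two triangles exchanged. *)
Lemma triangle_pullback_square A1 A2 B1 B2 D (x1 : hom A1 B1) (y1 : hom B1 D)
    (x2 : hom A2 B2) (y2 : hom B2 D) (d1 : eext C D A1) (d2 : eext C D A2) :
  realizes (ereal C) d1 (ShortSeq x1 y1) ->
  realizes (ereal C) d2 (ShortSeq x2 y2) ->
  exists M (m1 : hom A1 M) (m2 : hom A2 M) (e1 : hom M B1) (e2 : hom M B2),
    [/\ realizes (ereal C) (pull y2 d1) (ShortSeq m1 e2),
        realizes (ereal C) (pull y1 d2) (ShortSeq m2 e1)
      & e1 \c m1 = x1].
Proof.
move=> r1 r2; have [P] := (ecat_additive C).2 A1 A2.
have [M [g [g' r]]] :=
  realization_exists (push (bip_i1 P) d1 + push (bip_i2 P) d2).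
have [e2 [re2 _]] := sum_realization_quotient r2 r.
rewrite addrC in r.
have [e1 [re1 ex]] := sum_realization_quotient (P := bip_swap P) r1 r.
by exists M, (g \c bip_i1 P), (g \c bip_i2 P), e1, e2.
Qed.

(** [(x, f)] is the composite of the split inflation [(1, f)] with the
    inflation [x (+) 1], hence an inflation by (ET4). *)
Lemma inflation_pair A B D Y (x : hom A B) (y : hom B D) (d : eext C D A)
    (f : hom A Y) :
  realizes (ereal C) d (ShortSeq x y) ->
  exists (M : biproduct B Y) W (w : hom M W) (th : eext C W A),
    realizes (ereal C) th (ShortSeq (bip_i1 M \c x + bip_i2 M \c f) w).
Proof.
move=> r; have [P] := (ecat_additive C).2 A Y.
have [M] := (ecat_additive C).2 B Y.
have [W [w [_ [_ [th [r1 _]]]]]] :=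
  ecat_ET4 ((ereal_additive C).1 _ _ (bip_shear P f)) (triangle_add_id P M r).
exists M, W, w, th; move: r1; rewrite /= compDr compA.
by rewrite bip_map_i1 bip_map_i2 compm1.
Qed.

(** The carrier of the biproduct is [B] as an object, not up to isomorphism: this
    keeps membership in a subcategory that is not closed under isomorphisms. *)
Lemma split_triangle_biproduct A B D (x : hom A B) (y : hom B D) :
  realizes (ereal C) (0 : eext C D A) (ShortSeq x y) ->
  exists P : biproduct A D, bip_obj P = B.
Proof.
move=> r; have [|p px] := triangle_extend r (g := idm A); first exact: pushm0.
have [|q yq] := triangle_lift r (g := idm D); first exact: pullm0.
have yx := triangle_comp0 r.
(* the section [q] is corrected so that its [p]-component vanishes *)
pose s := q - x \c p \c q.
have ys : y \c s = idm D by rewrite compBr !compA yx !comp0m subr0 -yq.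
have ps : p \c s = 0 by rewrite compBr !compA -px comp1m subrr.
suff e : x \c p + s \c y = idm B.
  by exists (Biproduct (esym px) ys ps yx e).
have [|h eh] := triangle_weak_kernel r (g := idm B - (x \c p + s \c y)).
  by rewrite compBr compDr !compA yx comp0m add0r ys comp1m compm1 subrr.
have h0 : h = 0.
  rewrite -[h]comp1m px -compA -eh compBr compDr !compA -px ps comp1m comp0m.
  by rewrite compm1 addr0 subrr.
by apply/esym/subr0_eq; rewrite eh h0 compm0.
Qed.

End Constructions.

(** * Morphisms modulo the ideal of [X] *)

Section Modulo.
Variables (C : preadditive_category) (X : subcategory C).
Implicit Types A B D : C.

Definition mono_mod A B (f : hom A B) : Prop :=
  forall (G : C) (u : hom G A), factors_through X (f \c u) -> factors_through X u.

Definition epi_mod A B (f : hom A B) : Prop :=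
  forall (G : C) (u : hom B G), factors_through X (u \c f) -> factors_through X u.

Definition iso_mod A B (f : hom A B) : Prop :=
  exists g : hom B A, factors_through X (g \c f - idm A) /\
                      factors_through X (f \c g - idm B).

Definition kernel_mod K A B (k : hom K A) (f : hom A B) : Prop :=
  factors_through X (f \c k) /\
  forall (G : C) (g : hom G A), factors_through X (f \c g) ->
    exists h, factors_through X (k \c h - g).

Definition cokernel_mod A B Q (f : hom A B) (q : hom B Q) : Prop :=
  factors_through X (q \c f) /\
  forall (G : C) (g : hom B G), factors_through X (g \c f) ->
    exists h, factors_through X (h \c q - g).

(** The quotient category is balanced. *)
Definition balanced_mod : Prop :=
  forall A B (f : hom A B), mono_mod f -> epi_mod f -> iso_mod f.

Lemma factors_comp A M B (g : hom A M) (h : hom M B) :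
  X M -> factors_through X (h \c g).
Proof. by move=> XM; exists M, g, h. Qed.

Lemma factors_compl A B D (g : hom B D) (f : hom A B) :
  factors_through X f -> factors_through X (g \c f).
Proof. by move=> [M [a [b [XM ->]]]]; rewrite compA; apply: factors_comp. Qed.

Lemma factors_compr A B D (g : hom B D) (f : hom A B) :
  factors_through X g -> factors_through X (g \c f).
Proof. by move=> [M [a [b [XM ->]]]]; rewrite -compA; apply: factors_comp. Qed.

Lemma factors_opp A B (f : hom A B) :
  factors_through X f -> factors_through X (- f).
Proof. by move=> [M [a [b [XM ->]]]]; rewrite -compNr; apply: factors_comp. Qed.

Hypothesis hX : sum_closed X.

Lemma factors0 A B : factors_through X (0 : hom A B).
Proof.
by have [[Z [XZ _]] _] := hX; rewrite -(comp0m B (0 : hom A Z)); apply: factors_comp.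
Qed.

Lemma factorsB A B (f g : hom A B) :
  factors_through X f -> factors_through X g -> factors_through X (f - g).
Proof.
move=> hf hg; have [_ /(_ f g)] := hom_ideal_closed hX A B.
by move=> h; apply/asboolP/h; apply/asboolP.
Qed.

Lemma factorsD A B (f g : hom A B) :
  factors_through X f -> factors_through X g -> factors_through X (f + g).
Proof. by move=> hf hg; rewrite -[g]opprK; apply: factorsB => //; apply: factors_opp. Qed.

Lemma factors_sub A B (f g : hom A B) :
  factors_through X (f - g) -> factors_through X g -> factors_through X f.
Proof. by move=> hf hg; rewrite -[f](subrK g); apply: factorsD. Qed.

(** If [f] is the kernel of [q] and is epi, then [q] vanishes in the quotient, so
    the identity of [B] lifts along [f]. *)
Lemma monos_kernels_balanced :
  (forall A B (f : hom A B), mono_mod f ->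
     exists (D : C) (q : hom B D), kernel_mod f q) ->
  balanced_mod.
Proof.
move=> ker A B f fm fe; have [D [q [qf qk]]] := ker A B f fm.
have [|h hf] := qk _ (idm B); first by rewrite compm1; apply: fe.
exists h; split=> //; apply: fm.
have -> : f \c (h \c f - idm A) = (f \c h - idm B) \c f.
  by rewrite compBr compBl compA compm1 comp1m.
exact: factors_compr.
Qed.

End Modulo.

Section ModuloOpposite.
Variables (C : preadditive_category) (X : subcategory C).
Implicit Types A B D : C.

Lemma opp_factors A B (f : hom A B) :
  @factors_through (opp_cat C) X B A f <-> factors_through X f.
Proof. by split=> -[M [g [h [XM ->]]]]; exists M, h, g. Qed.

Lemma opp_sum_closed : sum_closed X -> @sum_closed (opp_cat C) X.
Proof.
case=> -[Z [XZ [Z1 Z2]]] bip; split.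
  by exists Z; do 2?split.
by move=> A B XA XB; have [P XP] := bip A B XA XB; exists (opp_bip P).
Qed.

Lemma opp_mono_mod A B (f : hom A B) :
  @mono_mod (opp_cat C) X B A f <-> epi_mod X f.
Proof.
split=> h G u hu.
  by apply/(opp_factors u)/h/(opp_factors (u \c f)).
apply/(@opp_factors B G u)/h/(@opp_factors A G (@comp C A B G u f)); exact hu.
Qed.

Lemma opp_epi_mod A B (f : hom A B) :
  @epi_mod (opp_cat C) X B A f <-> mono_mod X f.
Proof.
split=> h G u hu.
  by apply/(opp_factors u)/h/(opp_factors (f \c u)).
apply/(@opp_factors G A u)/h/(@opp_factors G B (@comp C G A B f u)); exact hu.
Qed.

Lemma opp_kernel_mod A B Q (f : hom A B) (q : hom B Q) :
  @kernel_mod (opp_cat C) X Q B A q f <-> cokernel_mod X f q.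
Proof.
split=> -[h0 h1]; split; try by apply/opp_factors.
  move=> G g /(opp_factors (g \c f)) /h1 [h hh]; exists h.
  by apply/(@opp_factors B G (@comp C B Q G h q - g)); exact: hh.
move=> G g /(@opp_factors A G (@comp C A B G g f)) /h1 [h hh]; exists h.
by apply/(@opp_factors B G (@comp C B Q G h q - g)); exact: hh.
Qed.

Lemma opp_balanced : balanced_mod X -> @balanced_mod (opp_cat C) X.
Proof.
move=> bal A B f fm fe.
have [||g [g1 g2]] := bal B A f; [exact/opp_epi_mod|exact/opp_mono_mod|].
by exists g; split; apply/opp_factors.
Qed.

End ModuloOpposite.

(** * Kernels modulo [X] and the splitting condition *)

Section PseudoClusterTilting.
Variables (C : extriangulated_category) (X : subcategory C).
Hypotheses (hX : sum_closed X) (hpct : pseudo_cluster_tilting X).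
Implicit Types A B D G K : C.

(** The common reformulation of balance and of self-orthogonality. *)
Definition monic_inflations_split : Prop :=
  forall A B D (t : etriangle A B D), X D -> contra_exact X t ->
    mono_mod X (tri_inf t) -> splits t.

Lemma contra_exactP A B D (t : etriangle A B D) :
  contra_exact X t <->
  forall M (v : hom A M), X M -> exists v', v' \c tri_inf t = v.
Proof.
split=> [e M v XM|e M XM]; first exact: (e M XM).2.
split=> v; last exact: e.
split=> [vx|[u <-]]; last by rewrite -compA (triangle_comp0 (tri_real t)) compm0.
by have [u ->] := triangle_weak_cokernel (tri_real t) vx; exists u.
Qed.

Lemma cov_exactP A B D (t : etriangle A B D) :
  cov_exact X t <->
  forall M (v : hom M D), X M -> exists v', tri_def t \c v' = v.
Proof.
split=> [e M v XM|e M XM]; first exact: (e M XM).2.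
split=> v; last exact: e.
split=> [yv|[u <-]]; last by rewrite compA (triangle_comp0 (tri_real t)) comp0m.
by have [u ->] := triangle_weak_kernel (tri_real t) yv; exists u.
Qed.

Section ApproximationPullback.
Variables (A B X3 X4 K : C) (x : hom X3 X4) (d : hom X4 B) (e : eext C B X3).
Variables (f : hom A B) (i : hom X3 K) (k : hom K A).
Hypotheses (rd : realizes (ereal C) e (ShortSeq x d))
  (ad : right_approximation X d) (X3X : X X3)
  (rk : realizes (ereal C) (pull f e) (ShortSeq i k)).

(** [f \c g] lifts to [X4] by approximation, hence kills [e]. *)
Lemma approx_pullback_lift G (g : hom G A) :
  factors_through X (f \c g) -> exists h, g = k \c h.
Proof.
move=> [M [a [b [XM fg]]]]; have [b' db] := ad.2 M b XM.
apply: (triangle_lift rk).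
by rewrite -pullM fg -db -compA pullM (triangle_pull0 rd) pullm0.
Qed.

(** If [k \c u] factors through [M] in [X], then so does [u] up to a map through
    [X3]: every map from [M] to [A] lifts along [k]. *)
Lemma approx_pullback_mono : mono_mod X k.
Proof.
move=> G u [M [a [b [XM ku]]]].
have [|b' bk] := approx_pullback_lift (g := b).
  by rewrite -[b]compm1 compA; apply: factors_comp.
have [|h uh] := triangle_weak_kernel rk (g := u - b' \c a).
  by rewrite compBr ku compA -bk subrr.
apply: (factors_sub hX (g := b' \c a)); last exact: factors_comp.
by rewrite uh; apply: factors_comp.
Qed.

Lemma approx_pullback_kernel : kernel_mod X k f.
Proof.
split=> [|G g /approx_pullback_lift [h ->]]; last first.
  by exists h; rewrite subrr; apply: factors0.
have [|c [_ <-]] := realizes_mor (a := idm X3) (c := f) rk rd.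
  by rewrite push1.
by apply: factors_comp; exact: ad.1.
Qed.

End ApproximationPullback.

Lemma kernels_mod_exist A B (f : hom A B) :
  exists K (k : hom K A), mono_mod X k /\ kernel_mod X k f.
Proof.
have [X3 [X4 [s [XX3 _ sa]]]] := hpct.2 B.
have [K [i [k rk]]] := realization_exists (pull f (tri_ext s)).
exists K, k; split.
  exact: (approx_pullback_mono (tri_real s) sa XX3 rk).
exact: (approx_pullback_kernel (tri_real s) sa rk).
Qed.

(** * Balance and monomorphisms as kernels *)

(** [q] is the cone of the inflation [(x, f)], with [x] a left approximation of
    [A], restricted to [B]; its kernel, computed by a right approximation [X4] of
    the cone, is the middle term of a triangle from [A] to [X4]. *)
Lemma monic_inflations_split_kernel :
  monic_inflations_split ->
  forall A B (f : hom A B), mono_mod X f ->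
    exists D (q : hom B D), kernel_mod X f q.
Proof.
move=> spl A B f fm.
have [X1 [X2 [t [XX1 XX2 ta]]]] := hpct.1 A.
have [M [W [w [th r1]]]] := inflation_pair f (tri_real t).
set j := _ + _ in r1.
have [X3 [X4 [s [XX3 XX4 sa]]]] := hpct.2 W.
have [E [m1 [m2 [e1 [e2 [rm re em]]]]]] :=
  triangle_pullback_square r1 (tri_real s).
have pj1 : bip_p1 M \c j = tri_inf t.
  by rewrite compDr !compA bip_p1i1 bip_p1i2 comp1m comp0m addr0.
have pj2 : bip_p2 M \c j = f.
  by rewrite compDr !compA bip_p2i1 bip_p2i2 comp1m comp0m add0r.
have fE : f = bip_p2 M \c e1 \c m1 by rewrite -compA em pj2.
have d0 : pull (tri_def s) th = 0.
  apply: (spl _ _ _ (ETriangle rm)) => //=.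
    apply/contra_exactP=> N v XN /=; have [h <-] := ta.2 N v XN.
    by exists (h \c bip_p1 M \c e1); rewrite -compA em -compA pj1.
  by move=> G u hu; apply: fm; rewrite fE -compA; apply: factors_compl.
have [|n nm] := triangle_extend rm (g := idm A); first by rewrite d0 pushm0.
exists W, (w \c bip_i2 M); split.
  have -> : w \c bip_i2 M \c f = - (w \c bip_i1 M \c tri_inf t).
    apply/eqP; rewrite -addr_eq0 addrC -!compA -compDr.
    by rewrite (triangle_comp0 r1).
  by apply: factors_opp; apply: factors_comp.
move=> G g; rewrite -compA => hg.
have [g' ge] := approx_pullback_lift (tri_real s) sa re hg.
have gE : g = bip_p2 M \c e1 \c g'.
  by rewrite -compA -ge compA bip_p2i2 comp1m.
exists (n \c g'); rewrite gE fE -!compA -!compBr.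
have [|u eu] := triangle_weak_cokernel rm (g := m1 \c n - idm E).
  by rewrite compBl -compA -nm compm1 comp1m subrr.
do 2! apply: factors_compl.
by rewrite compA -{2}[g']comp1m -compBl eu -compA; apply: factors_comp.
Qed.

(** An inflation that is invertible modulo [X] has a left inverse up to a map
    through [X]; such a map extends along the inflation, and subtracting the
    extension makes the left inverse exact. *)
Lemma balanced_monic_inflations_split :
  balanced_mod X -> monic_inflations_split.
Proof.
move=> bal A B D t XD /contra_exactP ext mm.
have me : epi_mod X (tri_inf t).
  move=> G u [M [a [b [XM um]]]]; have [a' aE] := ext M a XM.
  apply: (factors_sub hX (g := b \c a')); last exact: factors_comp.
  have [|h ->] := triangle_weak_cokernel (tri_real t) (g := u - b \c a').
    by rewrite compBl um -compA aE subrr.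
  exact: factors_comp.
have [n [[M [a [b [XM nm]]]] _]] := bal _ _ _ mm me.
have [a' aE] := ext M a XM.
have sec : (n - b \c a') \c tri_inf t = idm A.
  by rewrite compBl -compA aE -nm subKr.
by rewrite /splits -[tri_ext t]push1 -sec pushM (triangle_push0 (tri_real t)) pushm0.
Qed.

(** * Self-orthogonality with respect to the class S *)

(** The section of [M2 -> S3] lifts to [S2], where it is a section of [S2 -> S3]. *)
Lemma monic_inflations_split_orthogonal :
  monic_inflations_split -> self_orthogonal X (class_S X).
Proof.
move=> spl S1 S2 S3 t [U [M1 [M2 [r1 [r2 [c2 [[_ _ e12] [_ tc _] cov con]]]]]]].
move=> XS1 XS3; have {}cov := (cov_exactP r2).1 cov.
have mm : mono_mod X (tri_inf c2).
  move=> G g [M [a [b [XM mg]]]]; have [b' bE] := cov M b XM.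
  have [|h ->] := triangle_lift (tri_real r1) (g := g).
    rewrite -[tri_ext r1]push1 e12 -pullM mg -bE -compA pullM.
    by rewrite (triangle_pull0 (tri_real r2)) pullm0.
  exact: factors_comp.
have c0 : tri_ext c2 = 0 := spl _ _ _ c2 XS3 con mm.
have [|s sE] := triangle_lift (tri_real c2) (g := idm S3).
  by rewrite c0 pullm0.
have [s' s'E] := cov S3 s XS3.
rewrite comp1m in tc.
rewrite /splits -[tri_ext t]pull1 sE -s'E compA tc pullM.
by rewrite (triangle_pull0 (tri_real t)) pullm0.
Qed.

(** The kernel [K] of the inflation modulo [X] is the first term of a triangle
    [K -> X4 -> S3] in [S].  Orthogonality is applied to its sum with
    [X6 -> X6 -> 0], whose first term lies in [X]. *)
Lemma orthogonal_monic_inflations_split :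
  self_orthogonal X (class_S X) -> monic_inflations_split.
Proof.
move=> orth M1 M2 S3 t XS3 con mm.
have [X3 [X4 [s [XX3 XX4 sa]]]] := hpct.2 M2.
have [K [h [k [i [d3 [r3 [dh [hi [rk [kd yd]]]]]]]]]] :=
  ecat_ET4op (tri_real t) (tri_real s).
(* [K] is the kernel of a mono, hence zero in the quotient *)
have idK : factors_through X (idm K).
  apply: (approx_pullback_mono (tri_real s) sa XX3 rk).
  rewrite compm1; apply: mm; rewrite -dh.
  exact: factors_comp.
have [X5 [X6 [l [XX5 _ la]]]] := hpct.1 K.
(* so the approximation [K -> X5] is a section *)
have l0 : tri_ext l = 0.
  have [M [a [b [XM ab]]]] := idK; have [a' aE] := la.2 M a XM.
  rewrite -[tri_ext l]push1 ab -aE compA pushM.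
  by rewrite (triangle_push0 (tri_real l)) pushm0.
have [P PX] : exists P : biproduct K X6, bip_obj P = X5.
  by apply: (@split_triangle_biproduct C _ _ _ (tri_inf l) (tri_def l));
    rewrite -l0; apply: tri_real.
have XP : X P by rewrite PX.
have [Q] := (ecat_additive C).2 X4 X6.
have [U] := (ecat_additive C).2 X3 X6.
have d0 : push (bip_i1 P) d3 = 0.
  apply: (orth _ _ _ (ETriangle (triangle_add_id P Q r3))) => //.
  exists U, M1, M2, (ETriangle (triangle_add_id U P rk)),
    (ETriangle (triangle_add_id U Q (tri_real s))), t.
  have comm : tri_def s \c bip_p1 Q \c bip_map P Q h (idm X6) =
      tri_inf t \c (k \c bip_p1 P).
    by rewrite -compA bip_map_p1 compA dh -compA.
  split=> //.
  - split=> //=.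
      by rewrite bip_map_comp hi comp1m compm1.
    by rewrite push1 push_pull.
  - split=> //=; first by rewrite comp1m compA.
    by rewrite pull1 -pushM -compA bip_p1i1 compm1.
  - apply/cov_exactP=> N v XN /=; have [v' <-] := sa.2 N v XN.
    by exists (bip_i1 Q \c v'); rewrite compA -(compA (tri_def s)) bip_p1i1 compm1.
rewrite /splits -kd -[k]compm1 -(bip_p1i1 P) compA pushM d0.
exact: pushm0.
Qed.

Lemma orthogonal_balanced : self_orthogonal X (class_S X) <-> balanced_mod X.
Proof.
split=> [/orthogonal_monic_inflations_split spl|].
  exact: monos_kernels_balanced (monic_inflations_split_kernel spl).
by move/balanced_monic_inflations_split/monic_inflations_split_orthogonal.
Qed.

Lemma balanced_monos_kernels :
  balanced_mod X ->
  forall A B (f : hom A B), mono_mod X f ->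
    exists D (q : hom B D), kernel_mod X f q.
Proof.
by move/balanced_monic_inflations_split; apply: monic_inflations_split_kernel.
Qed.

End PseudoClusterTilting.

(** * Duality *)

Section Duality.
Variables (C : extriangulated_category) (X : subcategory C).
Implicit Types A B D : C.

Definition opp_triangle A B D (t : etriangle A B D) :
  @etriangle (opp_extri C) D B A :=
  @ETriangle (opp_extri C) D B A (tri_def t) (tri_inf t) (tri_ext t)
    (tri_real t).

Definition unopp_triangle A B D (t : @etriangle (opp_extri C) D B A) :
  etriangle A B D :=
  @ETriangle C A B D (tri_def t) (tri_inf t) (tri_ext t) (tri_real t).

Lemma opp_pseudo_cluster_tilting :
  pseudo_cluster_tilting X -> @pseudo_cluster_tilting (opp_extri C) X.
Proof.
move=> [l r]; split=> A.
  by have [X3 [X4 [t [X3X X4X ta]]]] := r A; exists X4, X3, (opp_triangle t).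
by have [X1 [X2 [t [X1X X2X ta]]]] := l A; exists X2, X1, (opp_triangle t).
Qed.

Lemma opp_class_S A B D (t : etriangle A B D) :
  @class_S (opp_extri C) X D B A (opp_triangle t) <-> class_T X t.
Proof.
split.
  move=> [V [N3 [N2 [c2 [c1 [r1 [[m1 m2 m3] [n1 n2 n3] cov con]]]]]]].
  exists N2, N3, V, (unopp_triangle r1), (unopp_triangle c1), (unopp_triangle c2).
  by split=> //; split; apply: esym.
move=> [N2 [N3 [V [r1 [c1 [c2 [[m1 m2 m3] [n1 n2 n3] con cov]]]]]]].
exists V, N3, N2, (opp_triangle c2), (opp_triangle c1), (opp_triangle r1).
by split=> //; split; apply: esym.
Qed.

Lemma opp_self_orthogonal :
  @self_orthogonal (opp_extri C) X (@class_S (opp_extri C) X) <->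
  self_orthogonal X (class_T X).
Proof.
split=> orth A B D t tY XA XD.
  by apply: (orth D B A (opp_triangle t)) => //; apply/opp_class_S.
apply: (orth D B A (unopp_triangle t)) => //.
by apply/opp_class_S; case: t tY.
Qed.

End Duality.

Section DualResults.
Variables (C : extriangulated_category) (X : subcategory C).
Hypotheses (hX : sum_closed X) (hpct : pseudo_cluster_tilting X).
Implicit Types A B D : C.

Let hXo : @sum_closed (opp_extri C) X := opp_sum_closed hX.
Let hpcto := opp_pseudo_cluster_tilting hpct.

Lemma dual_orthogonal_balanced :
  self_orthogonal X (class_T X) <-> balanced_mod X.
Proof.
rewrite -opp_self_orthogonal (orthogonal_balanced hXo hpcto).
by split; first exact: (@opp_balanced (opp_cat C) X); exact: opp_balanced.
Qed.

Lemma cokernels_mod_exist A B (f : hom A B) :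
  exists Q (q : hom B Q), epi_mod X q /\ cokernel_mod X f q.
Proof.
have [Q [q [qe qc]]] := @kernels_mod_exist (opp_extri C) X hXo hpcto B A f.
by exists Q, q; split; [apply/opp_mono_mod|apply/opp_kernel_mod].
Qed.

Lemma balanced_epis_cokernels :
  balanced_mod X ->
  forall A B (f : hom A B), epi_mod X f ->
    exists D (g : hom D A), cokernel_mod X g f.
Proof.
move=> bal A B f fe.
have [D [g gc]] := @balanced_monos_kernels (opp_extri C) X hXo hpcto
  (opp_balanced bal) B A f (proj2 (opp_mono_mod X f) fe).
by exists D, g; apply/opp_kernel_mod.
Qed.

End DualResults.

(** * The quotient category *)

Section Quotient.
Variables (C : preadditive_category) (X : subcategory C) (hX : sum_closed X).
Implicit Types A B D : C.

Let Q := quotient_category hX.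
Local Notation pi := (quot_pi hX).

Lemma quot_pi_eq0 A B (f : hom A B) : pi f = 0 <-> factors_through X f.
Proof.
have p0 : pi (0 : hom A B) = 0.
  by apply: (addrI (pi (0 : hom A B))); rewrite -quot_piD !addr0.
by rewrite -p0 quot_piP subr0.
Qed.

Lemma quot_is_mono A B (f : hom A B) :
  @is_mono Q A B (pi f) <-> mono_mod X f.
Proof.
split=> [fm G u fu|fm G u v].
  apply/quot_pi_eq0/(fm G); rewrite compm0.
  by rewrite /= -quot_piM; apply/quot_pi_eq0.
rewrite -[u]quot_reprK -[v]quot_reprK /= -!quot_piM => /quot_piP.
by move=> h; apply/quot_piP/(fm G); rewrite compBr.
Qed.

Lemma quot_is_epi A B (f : hom A B) :
  @is_epi Q A B (pi f) <-> epi_mod X f.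
Proof.
split=> [fm G u fu|fm G u v].
  apply/quot_pi_eq0/(fm G); rewrite comp0m.
  by rewrite /= -quot_piM; apply/quot_pi_eq0.
rewrite -[u]quot_reprK -[v]quot_reprK /= -!quot_piM => /quot_piP.
by move=> h; apply/quot_piP/(fm G); rewrite compBl.
Qed.

Lemma quot_is_kernel K A B (k : hom K A) (f : hom A B) :
  mono_mod X k -> kernel_mod X k f -> @is_kernel Q K A B (pi k) (pi f).
Proof.
move=> /quot_is_mono km [fk ker]; split.
  by rewrite /= -quot_piM; apply/quot_pi_eq0.
move=> G g; rewrite -[g]quot_reprK /= -quot_piM => /quot_pi_eq0 /ker [h hh].
exists (pi h); split; first by rewrite -quot_piM; apply/quot_piP.
by move=> u ku; apply: km; rewrite /= ku -quot_piM; apply/quot_piP.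
Qed.

Lemma quot_is_cokernel A B D (f : hom A B) (q : hom B D) :
  epi_mod X q -> cokernel_mod X f q -> @is_cokernel Q A B D (pi f) (pi q).
Proof.
move=> /quot_is_epi qe [qf cok]; split.
  by rewrite /= -quot_piM; apply/quot_pi_eq0.
move=> G g; rewrite -[g]quot_reprK /= -quot_piM => /quot_pi_eq0 /cok [h hh].
exists (pi h); split; first by rewrite -quot_piM; apply/quot_piP.
by move=> u ku; apply: qe; rewrite /= ku -quot_piM; apply/quot_piP.
Qed.

Lemma quot_kernel_mod A B D (f : hom A B) (g : @hom Q B D) :
  @is_kernel Q A B D (pi f) g -> kernel_mod X f (quot_repr g).
Proof.
rewrite -{1}[g]quot_reprK => -[gf ker]; split.
  by apply/quot_pi_eq0; rewrite quot_piM.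
move=> G h gh; have [|u [fu _]] := ker G (pi h).
  by rewrite /= -quot_piM; apply/quot_pi_eq0.
exists (quot_repr u); apply/quot_piP.
by rewrite quot_piM quot_reprK.
Qed.

Lemma quot_additive : is_additive C -> is_additive Q.
Proof.
move=> [[Z [Z1 Z2]] bip]; split.
  exists Z; split=> A f; rewrite -[f]quot_reprK.
    by rewrite (Z1 _ (quot_repr f)); apply/quot_pi_eq0/factors0.
  by rewrite (Z2 _ (quot_repr f)); apply/quot_pi_eq0/factors0.
move=> A B; have [P] := bip A B.
have pi0 D D' : pi (0 : hom D D') = 0 by apply/quot_pi_eq0/factors0.
exists; refine (@Biproduct Q A B P (pi (bip_i1 P)) (pi (bip_i2 P))
  (pi (bip_p1 P)) (pi (bip_p2 P)) _ _ _ _ _); rewrite /= -!quot_piM.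
- by rewrite bip_p1i1.
- by rewrite bip_p2i2.
- by rewrite bip_p1i2 pi0.
- by rewrite bip_p2i1 pi0.
- by rewrite -quot_piD bip_sum.
Qed.

Lemma quot_abelian_balanced : is_abelian Q -> balanced_mod X.
Proof.
case=> _ _ _ ker _; apply: monos_kernels_balanced => A B f /quot_is_mono fm.
have [D [g fg]] := ker _ _ _ fm.
by exists D, (quot_repr g); apply: quot_kernel_mod.
Qed.

End Quotient.

Lemma quot_abelian_iff_balanced (C : extriangulated_category)
    (X : subcategory C) (hX : sum_closed X) (hpct : pseudo_cluster_tilting X) :
  is_abelian (quotient_category hX) <-> balanced_mod X.
Proof.
split=> [|bal]; first exact: quot_abelian_balanced.
split.
- exact: quot_additive (ecat_additive C).
- move=> A B f; rewrite -[f]quot_reprK.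
  have [K [k [km ker]]] := kernels_mod_exist hX hpct (quot_repr f).
  by exists K, (quot_pi hX k); apply: quot_is_kernel.
- move=> A B f; rewrite -[f]quot_reprK.
  have [K [k [km ker]]] := cokernels_mod_exist hX hpct (quot_repr f).
  by exists K, (quot_pi hX k); apply: quot_is_cokernel.
- move=> A B f; rewrite -[f]quot_reprK => /quot_is_mono fm.
  have [D [q ker]] := balanced_monos_kernels hX hpct bal fm.
  by exists D, (quot_pi hX q); apply: quot_is_kernel.
- move=> A B f; rewrite -[f]quot_reprK => /quot_is_epi fe.
  have [D [q cok]] := balanced_epis_cokernels hX hpct bal fe.
  by exists D, (quot_pi hX q); apply: quot_is_cokernel.
Qed.

Theorem theorem3p15 (C : extriangulated_category) (X : subcategory C)
    (hX : sum_closed X) (hpct : pseudo_cluster_tilting X) :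
  (is_abelian (quotient_category hX) <-> self_orthogonal X (class_S X)) /\
  (self_orthogonal X (class_S X) <-> self_orthogonal X (class_T X)).
Proof.
rewrite (quot_abelian_iff_balanced hX hpct) (orthogonal_balanced hX hpct).
by rewrite (dual_orthogonal_balanced hX hpct).
Qed.
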